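(* Let $\tau$ be a regular tree set, let $\mathcal O=\mathcal O(\tau)$ be its set of consistent orientations, and for $\vec s\in\tau$ let $\mathcal O_{\vec s}=\{O\in\mathcal O:\vec s\in O\}$. Then for every $\vec s\in\tau$ the pair $(\mathcal O_{\overleftarrow s},\mathcal O_{\vec s})$ is a bipartition of $\mathcal O$, and the map $f:\vec s\mapsto(\mathcal O_{\overleftarrow s},\mathcal O_{\vec s})$ is an isomorphism of tree sets from $\tau$ onto its image $\vec{\mathcal N}(\tau)=f(\tau)\subseteq\vec S(\mathcal O)$.
   Context: A separation system $(\vec S,\le,{}^* )$ is a poset with an order-reversing involution; write $\overleftarrow s=\vec s^{\,*}$ and call $s=\{\vec s,\overleftarrow s\}$ a separation. $\vec s$ is degenerate if $\vec s=\overleftarrow s$, small if $\vec s\le\overleftarrow s$, trivial if there is a separation $t$ with $\vec s<\vec t$ and $\vec s<\overleftarrow t$. Regular: no small elements; essential: no trivial and no degenerate elements; nested: any two separations have comparable orientations. A tree set is a nested essential separation system; an isomorphism of tree sets is an order isomorphism commuting with the involutions. An orientation of $\tau$ is a set containing exactly one of $\vec s,\overleftarrow s$ for every separation $s$; it is consistent if there are no distinct separations $r\ne s$ with orientations $\vec r<\vec s$ and $\overleftarrow r,\vec s$ both in it. For a set $X$, $\vec S(X)$ is the separation system of bipartitions $(A,B)$ of $X$ (disjoint nonempty $A,B$ with $A\cup B=X$), ordered by $(A,B)\le(C,D)$ iff $A\subseteq C$, with involution $(A,B)\mapsto(B,A)$. *)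

(* Defs.v *)
From HB Require Import structures.
From mathcomp Require Import all_boot all_order.
From mathcomp Require Import boolp classical_sets functions.

Set Implicit Arguments.
Unset Strict Implicit.
Unset Printing Implicit Defensive.

Import Order.TTheory.
Local Open Scope order_scope.
Local Open Scope classical_set_scope.

(* The choiceType structure underlying porderType is no restriction: classically
   every type carries one (gen_choiceMixin). *)
HB.mixin Record isSepSystem (d : Order.disp_t) S of Order.POrder d S := {
  sinv : S -> S;
  sinvK : involutive sinv;
  sinv_le : forall r s : S, r <= s -> sinv s <= sinv r
}.

#[short(type="sepSystem")]
HB.structure Definition SepSystem (d : Order.disp_t) :=
  { S of Order.POrder d S & isSepSystem d S }.

(* The unoriented separation underlying s. *)
Definition sepn d (S : sepSystem d) (s : S) : set S := [set s; sinv s].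

(* A subset A of a separation system that is closed under the involution is
   itself a separation system for the induced order; the notions below are
   relative to such an A, and A = setT is the case of the whole system. *)
Section SepSystemTheory.
Context {d : Order.disp_t} {S : sepSystem d}.
Implicit Types (A O : set S) (r s t : S).

Definition sinv_closed A := forall s, A s -> A (sinv s).

Definition degenerate s := s = sinv s.
Definition small s := s <= sinv s.
Definition trivial A s := exists t, [/\ A t, s < t & s < sinv t].

Definition regular A := forall s, A s -> ~ small s.
Definition essential A := forall s, A s -> ~ trivial A s /\ ~ degenerate s.
Definition nested A := forall r s, A r -> A s ->
  exists r' s', [/\ sepn r r', sepn s s' & r' >=< s'].

Definition tree_set A := [/\ sinv_closed A, nested A & essential A].

Definition orientation A O :=
  O `<=` A /\ forall s, A s -> exists! r, sepn s r /\ O r.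
Definition consistent O :=
  ~ exists r s, [/\ sepn r <> sepn s, r < s, O (sinv r) & O s].
Definition consistent_orientations A : set (set S) :=
  [set O | orientation A O /\ consistent O].

Definition orientations_with A s : set (consistent_orientations A) :=
  [set O | \val O s].

End SepSystemTheory.

Arguments orientations_with {d S} A s _.

Definition tree_set_iso d d' (S : sepSystem d) (T : sepSystem d')
    (A : set S) (B : set T) (f : S -> T) :=
  [/\ tree_set A, tree_set B, set_bij A B f,
      {in A &, {mono f : r s / r <= s}} &
      {in A, {morph f : s / sinv s}}].

Definition is_bipartition (X : Type) (A B : set X) :=
  [/\ A !=set0, B !=set0, A `&` B = set0 & A `|` B = setT].

Record bipartition (X : Type) := Bipartition {
  bip_l : set X;
  bip_r : set X;
  bipP : is_bipartition bip_l bip_r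
}.

HB.instance Definition _ (X : Type) := gen_eqMixin (bipartition X).
HB.instance Definition _ (X : Type) := gen_choiceMixin (bipartition X).

Section Bipartition.
Variable X : Type.
Implicit Types p q : bipartition X.

Definition bip_le p q := `[< bip_l p `<=` bip_l q >].

Lemma bip_rE p : bip_r p = ~` bip_l p.
Proof.
case: p => A B /= [_ _ AB0 ABT]; rewrite eqEsubset; split=> x.
  by move=> Bx Ax; have : (A `&` B) x by []; rewrite AB0.
move=> nAx; have : (A `|` B) x by rewrite ABT.
by case.
Qed.

Lemma bip_eq p q : bip_l p = bip_l q -> p = q.
Proof.
move=> epq; have: bip_r p = bip_r q by rewrite !bip_rE epq.
case: p q epq => [A B pP] [C D qP] /= eAC eBD.
by subst; congr Bipartition; exact: Prop_irrelevance.
Qed.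

Lemma bip_le_refl : reflexive bip_le.
Proof. by move=> p; apply/asboolP. Qed.

Lemma bip_le_anti : antisymmetric bip_le.
Proof.
by move=> p q /andP[/asboolP pq /asboolP qp]; apply/bip_eq; rewrite eqEsubset.
Qed.

Lemma bip_le_trans : transitive bip_le.
Proof.
by move=> q p r /asboolP pq /asboolP qr; apply/asboolP => x /pq /qr.
Qed.

Fact bipartition_swap p : is_bipartition (bip_r p) (bip_l p).
Proof. by case: p => A B [? ? ? ?]; split=> //=; rewrite (setIC, setUC). Qed.

Definition bip_inv p := Bipartition (bipartition_swap p).

Lemma bip_invK : involutive bip_inv.
Proof. by move=> p; exact: bip_eq. Qed.

End Bipartition.

Fact bipartition_display : Order.disp_t. Proof. exact: Order.Disp tt tt. Qed.

HB.instance Definition _ (X : Type) :=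
  Order.Le_isPOrder.Build bipartition_display (bipartition X)
    (@bip_le_refl X) (@bip_le_anti X) (@bip_le_trans X).

Lemma bip_leE (X : Type) (p q : bipartition X) :
  (p <= q) = `[< bip_l p `<=` bip_l q >].
Proof. by []. Qed.

Fact bip_inv_le (X : Type) (p q : bipartition X) :
  p <= q -> bip_inv q <= bip_inv p.
Proof.
rewrite !bip_leE => /asboolP pq; apply/asboolP => /=.
by rewrite !bip_rE; exact: subsetC.
Qed.

HB.instance Definition _ (X : Type) :=
  isSepSystem.Build bipartition_display (bipartition X)
    (@bip_invK X) (@bip_inv_le X).

(* Main.v *)
(* In a regular system the consistent orientations are exactly the down-closed
   ones. If not [r <= s], then the down-closure of [sinv r] and [s] contains no
   separation together with its inverse, and a maximal down-closed set with this
   property is a consistent orientation by Zorn's lemma. So [f r <= f s] forces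
   [r <= s], and all tree-set axioms carry over to the image along the order
   embedding [f]. *)
Require Import Defs.
From HB Require Import structures.
From mathcomp Require Import all_boot all_order.
From mathcomp Require Import boolp classical_sets functions.

Local Open Scope order_scope.
Local Open Scope classical_set_scope.

Import Order.TTheory.

Section Orientations.
Context {d : Order.disp_t} {S : sepSystem d}.
Implicit Types (O M : set S) (r s t : S).

Definition down_closed O := forall r s, r <= s -> O s -> O r.
Definition antisymmetric_set O := forall s, O s -> ~ O (sinv s).

Lemma le_sinvl r s : sinv r <= s -> sinv s <= r.
Proof. by move=> /sinv_le; rewrite sinvK. Qed.

Hypothesis regS : regular [set: S].

Lemma regular_not_le s : ~ sinv s <= s.
Proof. by move=> h; apply: (regS (sinv s)) => //; rewrite /small sinvK. Qed.

Lemma regular_neq s : s <> sinv s.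
Proof. by move=> e; apply: (regS s) => //; rewrite /small -e. Qed.

(** By regularity [s] and [sinv s] always differ, so choosing exactly one of them amounts to
    antisymmetry and totality. If [r <= s] and [O s] but not [O r], then totality gives
    [O (sinv r)], against consistency. *)
Lemma consistent_orientationsP O :
  consistent_orientations [set: S] O <->
  [/\ down_closed O, antisymmetric_set O & forall s, O s \/ O (sinv s)].
Proof.
split.
  case=> -[_ ori] cons.
  have anti : antisymmetric_set O.
    move=> s Os Ois; have [r [_ uni]] := ori s I.
    apply: (regular_neq s); rewrite -[LHS]uni; last by split=> //; left.
    by apply: uni; split=> //; right.
  have tot s : O s \/ O (sinv s).
    by have [r [[[->|->] Or] _]] := ori s I; [left|right].
  split=> // r s rs Os; have [//|Oir] := tot r.
  exfalso; apply: cons; exists r, s; split=> //.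
    (* If [r] and [s] were the same separation, [r = s] would contradict antisymmetry and
       [r = sinv s] would make [sinv s] small. *)
    move=> e; have : sepn s r by rewrite -e; left.
    case=> er; first by apply: (anti s) => //; rewrite -er.
    by apply: (regular_not_le s); rewrite -er.
  by rewrite lt_neqAle rs andbT; apply/eqP => e; apply: (anti s) => //; rewrite -e.
case=> down anti tot; split.
  split=> // s _; have [Os|Os] := tot s.
    by exists s; split=> [|t [[->|->]]] //; [split=> //; left|move/anti: Os].
  by exists (sinv s); split=> [|t [[->|->]]] //; [split=> //; right|move/anti].
by move=> [r [s [_ /ltW rs Oir Os]]]; apply: (anti r) => //; exact: down Os.
Qed.

Lemma extend_consistent_orientation B :
  down_closed B -> antisymmetric_set B ->
  exists2 O, consistent_orientations [set: S] O & B `<=` O.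
Proof.
move=> downB antiB.
(* [M `|` B] rather than [M], so that the empty chain also has an upper bound. *)
pose P M := down_closed (M `|` B) /\ antisymmetric_set (M `|` B).
have [F FP Ftot|M [[downM antiM] maxM]] := @Zorn_bigcup _ P.
  split=> [r s rs [[M FM Ms]|Bs]|s [[M FM Ms]|Bs] [[N FN Ns]|Bis]].
  - have [down _] := FP _ FM.
    by have [Mr|Br] := down _ _ rs (or_introl Ms); [left; exists M|right].
  - by right; exact: downB Bs.
  - have [MN|NM] := Ftot _ _ FM FN.
      by apply: ((FP _ FN).2 s); left => //; exact: MN.
    by apply: ((FP _ FM).2 s); left => //; exact: NM.
  - by apply: ((FP _ FM).2 s); [left|right].
  - by apply: ((FP _ FN).2 s); [right|left].
  - exact: antiB Bis.
exists (M `|` B); last by move=> s; right.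
apply/consistent_orientationsP; split=> // s.
have [|nOis] := pselect ((M `|` B) (sinv s)); first by right.
(* Adjoining everything below [s] is harmless: an inverse pair with one member below [s] would have
   [sinv s] below the other, so [sinv s] would lie in [M]|[B] or below [s]. Maximality of [M] then
   forces [M s]. *)
left; pose N := M `|` [set r | r <= s].
have PN : P N.
  split=> [r t rt [[Mt|/= ts]|Bt]|t].
  - by have [?|?] := downM _ _ rt (or_introl Mt); [left; left|right].
  - by left; right; exact: le_trans ts.
  - by right; exact: downB Bt.
  have NE u : (N `|` B) u -> (M `|` B) u \/ u <= s.
    by case=> [[Mu|us]|Bu]; [left; left|right|left; right].
  move=> /NE[Ot|ts] /NE[Oit|its].
  - exact: antiM Oit.
  - by apply: nOis; apply: downM Ot; exact: le_sinvl.
  - by apply: nOis; apply: downM Oit; exact: sinv_le.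
  - by apply: (regular_not_le s); apply: le_trans ts; exact: le_sinvl.
have [Ms|nMs] := pselect (M s); first by left.
exfalso; apply: (maxM N) => //; split; first by move=> r; left.
by move=> /(_ s) h; apply: nMs; apply: h; right => /=.
Qed.

(** An inverse pair in the down-closure of [r] and [s] would give [sinv r <= r], [sinv s <= s] or
    [sinv r <= s]. Regularity excludes the first two, the hypothesis the third. *)
Lemma consistent_orientation_through r s : ~ sinv r <= s ->
  exists O : consistent_orientations [set: S], \val O r /\ \val O s.
Proof.
move=> nrs.
have [||O Oco BO] := @extend_consistent_orientation [set t | t <= r \/ t <= s].
- by move=> t u tu [ur|us]; [left|right]; exact: le_trans tu _.
- move=> t [tr|ts] [itr|its].
  + by apply: (regular_not_le r); apply: le_trans tr; exact: le_sinvl.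
  + by apply: nrs; apply: le_trans its; exact: sinv_le.
  + by apply: nrs; apply: le_trans ts; exact: le_sinvl.
  + by apply: (regular_not_le s); apply: le_trans ts; exact: le_sinvl.
by exists (SigSub (mem_set Oco)); split; apply: BO; [left|right].
Qed.

Lemma orientations_with_bipartition s :
  is_bipartition (orientations_with [set: S] (sinv s))
                 (orientations_with [set: S] s).
Proof.
split.
(* With both arguments equal, the hypothesis of the lemma is just regularity. *)
- have [|O [Os _]] := @consistent_orientation_through (sinv s) (sinv s).
    exact: regular_not_le.
  by exists O.
- have [|O [Os _]] := @consistent_orientation_through s s.
    exact: regular_not_le.
  by exists O.
- rewrite -subset0 => O [Ois Os].
  by have /consistent_orientationsP[_ /(_ s Os)] := set_valP O.
- rewrite -subTset => O _.
  by have /consistent_orientationsP[_ _ /(_ s)[]] := set_valP O; [right|left].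
Qed.

Lemma orientations_with_subset r s :
  orientations_with [set: S] (sinv r) `<=` orientations_with [set: S] (sinv s)
  <-> r <= s.
Proof.
split=> [sub|rs O Oir].
  apply: contrapT => nrs.
  (* This orientation contains [sinv r] but, by antisymmetry, not [sinv s], so it refutes the
     inclusion. *)
  have [|O [Oir Os]] := @consistent_orientation_through (sinv r) s.
    by rewrite sinvK.
  have /consistent_orientationsP[_ /(_ s Os) nOis _] := set_valP O.
  exact/nOis/sub.
have /consistent_orientationsP[down _ _] := set_valP O.
by apply: down Oir; exact: sinv_le.
Qed.

End Orientations.

(** Triviality relative to [range f] has its witness in [range f], so the witness pulls back to [S],
    as [f] reflects the strict order. *)
Lemma embedding_tree_set_iso {d d' : Order.disp_t} {S : sepSystem d}
    {T : sepSystem d'} {f : S -> T} :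
  tree_set [set: S] -> {mono f : r s / r <= s} ->
  {morph f : s / sinv s} -> tree_set_iso [set: S] (range f) f.
Proof.
move=> treeS mono morph; have [_ nestS essS] := treeS.
have f_inj : injective f := inc_inj mono.
split=> //; last by split=> // r s _ _ /f_inj.
split.
- by move=> _ [s _ <-]; exists (sinv s).
- move=> _ _ [r _ <-] [s _ <-].
  have sepf u v : sepn u v -> sepn (f u) (f v).
    by case=> ->; [left|right; rewrite morph].
  have [r' [s' [rr' ss' cmp]]] := nestS r s I I.
  exists (f r'), (f s'); split; [exact: sepf|exact: sepf|].
  by rewrite /Order.comparable !mono.
- move=> _ [s _ <-]; have [ntriv ndeg] := essS s I; split.
    move=> [_ [[t _ <-]]]; rewrite -morph !(leW_mono mono) => st sit.
    by apply: ntriv; exists t.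
  by rewrite /degenerate -morph => /f_inj.
Qed.

Theorem theorem5p2 (d : Order.disp_t) (tau : sepSystem d)
    (tau_tree_set : tree_set [set: tau]) (tau_regular : regular [set: tau]) :
  exists bip : forall s : tau,
      is_bipartition (orientations_with [set: tau] (sinv s))
                     (orientations_with [set: tau] s),
    let f := fun s : tau => Bipartition (bip s) in
    tree_set_iso [set: tau] (range f) f.
Proof.
exists (orientations_with_bipartition tau_regular).
apply: embedding_tree_set_iso => // [r s|s].
  rewrite bip_leE /=; apply/asboolP/idP;
    by move/(orientations_with_subset tau_regular).
(* A bipartition is determined by its left side; here both left sides are [orientations_with
   [set: tau] s]. *)
by apply: bip_eq => /=; rewrite sinvK.
Qed.
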